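(* Let $E$ be an order continuous Banach lattice. Then there exist a Hausdorff topological space $X$ and an injective lattice homomorphism $T:E\to S(X)$ whose image $T(E)$ is an (order dense) ideal of $S(X)$, such that $T$ is a homeomorphism from $(E,un)$ onto $T(E)$ equipped with the (subspace topology of the) extended $un$-topology $\tau_E$ on $S(X)$ induced by $T(E)\cong E$.
   Context: For a topological space $X$, $S(X)$ is the Archimedean vector lattice of equivalence classes of continuous real-valued functions defined on open dense subsets of $X$ (identified when they agree on the intersection of domains), with pointwise operations. A Banach lattice is order continuous if $x_\alpha\downarrow0$ implies $\|x_\alpha\|\to0$. In a Banach lattice $E$, a net $(x_\alpha)$ is $un$-convergent to $x$ if $\||x_\alpha-x|\wedge w\|\to0$ for every $w\in E_+$; this defines the $un$-topology. If $Y$ is an Archimedean vector lattice and $I\subseteq Y$ is an ideal which is a normed lattice, the extended $un$-topology on $Y$ induced by $I$ is given by: $y_\alpha\to y$ iff $\||y_\alpha-y|\wedge w\|\to0$ for every $w\in I_+$ (here $T(E)$ carries the norm transported from $E$). *)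

(* Defs.v *)
From HB Require Import structures.
From mathcomp Require Import all_boot all_order all_algebra.
From mathcomp Require Import all_classical all_reals all_analysis.
Set Implicit Arguments. Unset Strict Implicit. Unset Printing Implicit Defensive.
Import Order.TTheory GRing.Theory Num.Theory.
Import numFieldNormedType.Exports.
Local Open Scope classical_set_scope.
Local Open Scope ring_scope.

Definition directed (I : Type) (leI : I -> I -> Prop) : Prop :=
  [/\ inhabited I, (forall i, leI i i),
      (forall i j k, leI i j -> leI j k -> leI i k) &
      (forall i j, exists k, leI i k /\ leI j k)].

Definition eventually (I : Type) (leI : I -> I -> Prop) (P : I -> Prop) : Prop :=
  exists i0, forall i, leI i0 i -> P i.

Definition labs (R : realType) (V : completeNormedModType R)
  (join : V -> V -> V) (x : V) : V := join x (- x).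

Record banach_lattice (R : realType) (V : completeNormedModType R)
  (le : V -> V -> Prop) (join meet : V -> V -> V) : Prop := {
  bl_refl : forall x, le x x;
  bl_antisym : forall x y, le x y -> le y x -> x = y;
  bl_trans : forall x y z, le x y -> le y z -> le x z;
  bl_join_ub : forall x y, le x (join x y) /\ le y (join x y);
  bl_join_least : forall x y z, le x z -> le y z -> le (join x y) z;
  bl_meet_lb : forall x y, le (meet x y) x /\ le (meet x y) y;
  bl_meet_greatest : forall x y z, le z x -> le z y -> le z (meet x y);
  bl_add : forall x y z, le x y -> le (x + z) (y + z);
  bl_scale : forall (a : R) x y, 0 <= a -> le x y -> le (a *: x) (a *: y);
  bl_norm : forall x y, le (labs join x) (labs join y) -> `|x| <= `|y|
}.

Definition order_continuous (R : realType) (V : completeNormedModType R)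
  (le : V -> V -> Prop) : Prop :=
  forall (I : Type) (leI : I -> I -> Prop) (x : I -> V),
    directed leI ->
    (forall i j, leI i j -> le (x j) (x i)) ->
    (forall i, le 0 (x i)) ->
    (forall z, (forall i, le z (x i)) -> le z 0) ->
    forall eps : R, 0 < eps -> eventually leI (fun i => `|x i| < eps).

Definition un_conv (R : realType) (V : completeNormedModType R)
  (le : V -> V -> Prop) (join meet : V -> V -> V)
  (I : Type) (leI : I -> I -> Prop) (x : I -> V) (x0 : V) : Prop :=
  forall w : V, le 0 w -> forall eps : R, 0 < eps ->
    eventually leI (fun i => `|meet (labs join (x i - x0)) w| < eps).

(** A representative of an element of S(X): a continuous real function
    defined on an open dense subset of X.  (Values outside [sdom] are
    irrelevant.) *)
Record SRep (R : realType) (X : topologicalType) := {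
  sdom : set X;
  sfun : X -> R;
  sdom_open : open sdom;
  sdom_dense : dense sdom;
  sfun_cont : {within sdom, continuous sfun}
}.

(** The identification: two representatives define the same element of
    S(X) iff they agree on the intersection of their domains. *)
Definition sequiv (R : realType) (X : topologicalType) (a b : SRep R X) : Prop :=
  forall x, sdom a x -> sdom b x -> sfun a x = sfun b x.

(** Pointwise operations on S(X), expressed as relations on representatives:
    [s] represents the class of [op a b].  Since domains are open dense and
    functions continuous, agreement on the common (open dense) domain
    determines the class. *)
Definition sbin_rel (R : realType) (X : topologicalType) (op : R -> R -> R)
  (a b s : SRep R X) : Prop :=
  forall x, sdom a x -> sdom b x -> sdom s x -> sfun s x = op (sfun a x) (sfun b x).

Definition sscale_rel (R : realType) (X : topologicalType) (c : R)
  (a s : SRep R X) : Prop :=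
  forall x, sdom a x -> sdom s x -> sfun s x = c * sfun a x.

Definition sle (R : realType) (X : topologicalType) (a b : SRep R X) : Prop :=
  forall x, sdom a x -> sdom b x -> sfun a x <= sfun b x.

Definition spos (R : realType) (X : topologicalType) (a : SRep R X) : Prop :=
  forall x, sdom a x -> 0 <= sfun a x.

Definition snonzero (R : realType) (X : topologicalType) (a : SRep R X) : Prop :=
  exists x, sdom a x /\ sfun a x != 0.

(** [J] (a set of representatives, closed under [sequiv]) is an ideal of S(X). *)
Definition sideal (R : realType) (X : topologicalType) (J : SRep R X -> Prop) : Prop :=
  [/\ (forall a, (forall x, sdom a x -> sfun a x = 0) -> J a),
      (forall a b s, J a -> J b -> sbin_rel +%R a b s -> J s),
      (forall c a s, J a -> sscale_rel c a s -> J s) &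
      (forall a b, J a ->
         (forall x, sdom a x -> sdom b x -> `|sfun b x| <= `|sfun a x|) -> J b)].

Definition sorder_dense (R : realType) (X : topologicalType) (J : SRep R X -> Prop) : Prop :=
  forall s, spos s -> snonzero s ->
    exists t, [/\ J t, spos t, snonzero t & sle t s].

Definition simage (R : realType) (V : completeNormedModType R) (X : topologicalType)
  (T : V -> SRep R X) : SRep R X -> Prop :=
  fun s => exists e, sequiv (T e) s.

(** Extended un-convergence on S(X) induced by the ideal T(E), carrying the
    norm transported from E (||T e|| := ||e||):
    y_alpha -> y iff for every w in T(E)_+,  || |y_alpha - y| /\ w || -> 0.
    Here "|y_alpha - y| /\ w = T e" is expressed pointwise on common domains. *)
Definition ext_un_conv (R : realType) (V : completeNormedModType R)
  (X : topologicalType) (T : V -> SRep R X)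
  (I : Type) (leI : I -> I -> Prop) (y : I -> SRep R X) (y0 : SRep R X) : Prop :=
  forall w : SRep R X, simage T w -> spos w ->
  forall eps : R, 0 < eps ->
    eventually leI (fun i => exists e : V,
      (forall x, sdom (T e) x -> sdom (y i) x -> sdom y0 x -> sdom w x ->
         sfun (T e) x = Num.min `|sfun (y i) x - sfun y0 x| (sfun w x))
      /\ `|e| < eps).

(* Main.v *)
(** Let [X] be the set of maximal filters [w] of nonzero positive elements of [E], with the
    topology generated by the sets [{w | e \in w}]. At each [w] the relation "[(a - b)^+] is
    disjoint from some member of [w]" is a total linear preorder on [E]. Fixing a maximal
    disjoint family [D], whose members play the part of a weak unit, the value of [e] at [w]
    is measured in that preorder against the member [u] of [D] lying in [w]; it is finite on
    an open dense set. This gives an injective lattice homomorphism [E -> S(X)] with order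
    dense image. Order continuity makes [E] Dedekind complete, and an order dense Dedekind
    complete sublattice is an ideal: an [s] in [S(X)] dominated by the image of [E] is the
    image of [sup {x | T x <= s}], since any gap between the two would contain the image
    of a nonzero positive element. The un-convergences then agree because
    [T (|x - y| /\ w) = |T x - T y| /\ T w]. *)

Require Import Defs.
From HB Require Import structures.
From mathcomp Require Import all_boot all_order all_algebra.
From mathcomp Require Import all_classical all_reals all_analysis.
From mathcomp Require Import lra.
Import Order.TTheory GRing.Theory Num.Theory.
Import numFieldNormedType.Exports.
Local Open Scope classical_set_scope.
Local Open Scope ring_scope.

(** * Densely defined continuous functions *)

Section DenselyDefined.
Set Implicit Arguments.
Unset Strict Implicit.
Variables (R : realType) (X : topologicalType).
Implicit Types (a b : SRep R X) (f g : X -> R) (W : set X).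

Lemma sfun_continuous a x : sdom a x -> {for x, continuous (Defs.sfun a)}.
Proof.
move=> ax; have := @sfun_cont R X a.
by rewrite (continuous_open_subspace _ (@sdom_open R X a)); apply; exact/mem_set.
Qed.

Lemma continuous_norm_at f x : {for x, continuous f} ->
  {for x, continuous (fun y => `|f y|)}.
Proof. exact: cvg_norm. Qed.

Lemma continuous_dist_at f g x : {for x, continuous f} -> {for x, continuous g} ->
  {for x, continuous (fun y => `|f y - g y|)}.
Proof. by move=> cf cg; apply: continuous_norm_at; exact: cvgB. Qed.

Lemma nbhs_sdom a x : sdom a x -> nbhs x (sdom a).
Proof. by move=> ax; apply: open_nbhs_nbhs; split => //; exact: sdom_open. Qed.

Lemma nbhs_openI (A B : set X) x : nbhs x A -> nbhs x B ->
  exists G : set X, [/\ open G, G x & forall y, G y -> A y /\ B y].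
Proof.
move=> xA xB; have : nbhs x (A `&` B) by exact: filterI.
by rewrite nbhsE => -[G [oG Gx] GAB]; exists G.
Qed.

(** Half of the gap at [x] survives nearby. The uniform margin [r] is what later leaves room for a
    small bump. *)
Lemma near_lt_gap f g x : {for x, continuous f} -> {for x, continuous g} ->
  f x < g x -> exists2 r : R, 0 < r & \forall y \near x, f y + r <= g y.
Proof.
move=> cf cg fg; exists ((g x - f x) / 2); first lra.
have c : g y - f y @[y --> x] --> g x - f x by exact: cvgB.
have : (g x - f x) / 2 < g x - f x by lra.
move=> /(cvgr_gt _ c); apply: filterS => y; lra.
Qed.

(** A strict reverse inequality at [x] would persist on a neighbourhood, and that neighbourhood
    meets [W]. Identities therefore need checking only where all terms are finite. *)
Lemma le_of_dense W f g x : dense W -> {for x, continuous f} -> {for x, continuous g} ->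
  (\forall y \near x, W y -> f y <= g y) -> f x <= g x.
Proof.
move=> dW cf cg fg; rewrite leNgt; apply/negP => /(near_lt_gap cg cf)[r r0 h].
have [G [oG Gx GP]] := nbhs_openI fg h.
have [y [Gy Wy]] := dW G (ex_intro _ x Gx) oG.
have [/(_ Wy)] := GP _ Gy; lra.
Qed.

Lemma eq_of_dense W f g x : dense W -> {for x, continuous f} -> {for x, continuous g} ->
  (\forall y \near x, W y -> f y = g y) -> f x = g x.
Proof.
move=> dW cf cg fg; apply/eqP; rewrite eq_le; apply/andP; split;
  apply: (@le_of_dense W) => //; apply: filterS fg => y h /h; lra.
Qed.

Lemma sle_of_dense W a b : dense W ->
  (forall x, W x -> sdom a x -> sdom b x -> Defs.sfun a x <= Defs.sfun b x) -> sle a b.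
Proof.
move=> dW h x ax bx; apply: (le_of_dense dW); try exact: sfun_continuous.
by apply: filterS2 (nbhs_sdom ax) (nbhs_sdom bx) => y ay yb Wy; exact: h.
Qed.

Lemma sequiv_of_dense W a b : dense W ->
  (forall x, W x -> sdom a x -> sdom b x -> Defs.sfun a x = Defs.sfun b x) -> sequiv a b.
Proof.
move=> dW h x ax bx; apply: (eq_of_dense dW); try exact: sfun_continuous.
by apply: filterS2 (nbhs_sdom ax) (nbhs_sdom bx) => y ay yb Wy; exact: h.
Qed.

Lemma dense_sdomI a W : dense W -> dense (sdom a `&` W).
Proof. by apply: denseI; [exact: sdom_open|exact: sdom_dense]. Qed.

End DenselyDefined.

(** * Banach lattices *)

Section VectorLattice.
Set Implicit Arguments.
Unset Strict Implicit.
Variables (R : realType) (E : completeNormedModType R).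
Variables (le : E -> E -> Prop) (join meet : E -> E -> E).
Hypothesis BL : banach_lattice le join meet.
Implicit Types (x y z a b c d e f g u : E) (r s t : R).

Let le_refl x : le x x. Proof. exact: (bl_refl BL). Qed.
Let le_tr y x z : le x y -> le y z -> le x z.
Proof. exact: (bl_trans BL). Qed.

Definition pos x := join x 0.

Lemma le_joinl x y : le x (join x y).
Proof. by case: (bl_join_ub BL x y). Qed.

Lemma le_joinr x y : le y (join x y).
Proof. by case: (bl_join_ub BL x y). Qed.

Lemma le_meetl x y : le (meet x y) x.
Proof. by case: (bl_meet_lb BL x y). Qed.

Lemma le_meetr x y : le (meet x y) y.
Proof. by case: (bl_meet_lb BL x y). Qed.

Lemma leD a b c d : le a b -> le c d -> le (a + c) (b + d).
Proof.
move=> ab cd; apply: (le_tr (bl_add BL c ab)).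
by rewrite ![b + _]addrC; exact: (bl_add BL).
Qed.

Lemma le_subl x y z : le (x - y) z -> le x (z + y).
Proof. by move=> /(bl_add BL y); rewrite subrK. Qed.

Lemma le_subr x y z : le x (z + y) -> le (x - y) z.
Proof. by move=> /(bl_add BL (- y)); rewrite addrK. Qed.

Lemma sub_ge0 x y : le 0 (y - x) <-> le x y.
Proof.
split=> [/(bl_add BL x)|xy]; first by rewrite subrK add0r.
by rewrite -(subrr x); exact: (bl_add BL).
Qed.

Lemma leN x y : le x y -> le (- y) (- x).
Proof. by move/sub_ge0=> h; apply/sub_ge0; rewrite opprK addrC. Qed.

Lemma scale_ge0 r x : 0 <= r -> le 0 x -> le 0 (r *: x).
Proof. by move=> r0 /(bl_scale BL r0); rewrite scaler0. Qed.

Lemma le_scalel r s x : r <= s -> le 0 x -> le (r *: x) (s *: x).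
Proof.
by move=> rs x0; apply/sub_ge0; rewrite -scalerBl; apply: scale_ge0; rewrite ?subr_ge0.
Qed.

Lemma meetC x y : meet x y = meet y x.
Proof.
by apply: (bl_antisym BL); apply: (bl_meet_greatest BL);
  by [exact: le_meetl|exact: le_meetr].
Qed.

Lemma joinC x y : join x y = join y x.
Proof.
by apply: (bl_antisym BL); apply: (bl_join_least BL);
  by [exact: le_joinl|exact: le_joinr].
Qed.

Lemma joinDr x y z : join (x + z) (y + z) = join x y + z.
Proof.
apply: (bl_antisym BL).
  by apply: (bl_join_least BL); apply: (bl_add BL); [exact: le_joinl|exact: le_joinr].
rewrite -[X in le _ X](subrK z); apply: (bl_add BL); apply: (bl_join_least BL).
  by rewrite -[X in le X _](addrK z); apply: (bl_add BL); exact: le_joinl.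
by rewrite -[X in le X _](addrK z); apply: (bl_add BL); exact: le_joinr.
Qed.

Lemma meetDr x y z : meet (x + z) (y + z) = meet x y + z.
Proof.
apply: (bl_antisym BL); last first.
  by apply: (bl_meet_greatest BL); apply: (bl_add BL); [exact: le_meetl|exact: le_meetr].
rewrite -[X in le X _](subrK z); apply: (bl_add BL); apply: (bl_meet_greatest BL).
  by rewrite -[X in le _ X](addrK z); apply: (bl_add BL); exact: le_meetl.
by rewrite -[X in le _ X](addrK z); apply: (bl_add BL); exact: le_meetr.
Qed.

Lemma meetN x y : meet (- x) (- y) = - join x y.
Proof.
apply: (bl_antisym BL).
  rewrite -[X in le X _]opprK; apply: leN; apply: (bl_join_least BL).
    by rewrite -[X in le X _]opprK; apply: leN; exact: le_meetl.
  by rewrite -[X in le X _]opprK; apply: leN; exact: le_meetr.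
by apply: (bl_meet_greatest BL); apply: leN; [exact: le_joinl|exact: le_joinr].
Qed.

Lemma meet_idl x y : le x y -> meet x y = x.
Proof.
move=> xy; apply: (bl_antisym BL); first exact: le_meetl.
exact: (bl_meet_greatest BL).
Qed.

Lemma join_idr x y : le x y -> join x y = y.
Proof.
move=> xy; apply: (bl_antisym BL); last exact: le_joinr.
exact: (bl_join_least BL).
Qed.

Lemma meet_ge0 x y : le 0 x -> le 0 y -> le 0 (meet x y).
Proof. exact: (bl_meet_greatest BL). Qed.

Lemma le_meet a b c d : le a b -> le c d -> le (meet a c) (meet b d).
Proof.
move=> ab cd; apply: (bl_meet_greatest BL).
  by apply: le_tr ab; exact: le_meetl.
by apply: le_tr cd; exact: le_meetr.
Qed.

Lemma meetA x y z : meet x (meet y z) = meet (meet x y) z.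
Proof.
apply: (bl_antisym BL); repeat apply: (bl_meet_greatest BL).
- exact: le_meetl.
- by apply: (le_tr (le_meetr _ _)); exact: le_meetl.
- by apply: (le_tr (le_meetr _ _)); exact: le_meetr.
- by apply: (le_tr (le_meetl _ _)); exact: le_meetl.
- by apply: (le_tr (le_meetl _ _)); exact: le_meetr.
- exact: le_meetr.
Qed.

Lemma pos_ge0 x : le 0 (pos x).
Proof. exact: le_joinr. Qed.

Lemma le_pos x : le x (pos x).
Proof. exact: le_joinl. Qed.

Lemma pos_le x y : le x y -> le 0 y -> le (pos x) y.
Proof. exact: (bl_join_least BL). Qed.

Lemma pos_eq0 x : le x 0 -> pos x = 0.
Proof. exact: join_idr. Qed.

Lemma pos_eq0_le x : pos x = 0 -> le x 0.
Proof. by move=> <-; exact: le_pos. Qed.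

Lemma le_pos2 x y : le x y -> le (pos x) (pos y).
Proof. by move=> xy; apply: pos_le (pos_ge0 _); apply: le_tr xy (le_pos _). Qed.

Lemma posD x y : le (pos (x + y)) (pos x + pos y).
Proof.
apply: pos_le; first by apply: leD; exact: le_pos.
by rewrite -(addr0 0); apply: leD; exact: pos_ge0.
Qed.

Lemma posZ r x : 0 <= r -> le (pos (r *: x)) (r *: pos x).
Proof.
move=> r0; apply: pos_le; last exact: scale_ge0 (pos_ge0 _).
by apply: (bl_scale BL) => //; exact: le_pos.
Qed.

(** Since [x^+ = x + x^-], translation gives [x^+ /\ x^- = (x /\ 0) + x^-], and [x /\ 0 = - x^-]. *)
Lemma disj_pos x : meet (pos x) (pos (- x)) = 0.
Proof.
have -> : pos x = x + pos (- x).
  by rewrite addrC /pos -joinDr addNr add0r joinC.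
rewrite -{2}(add0r (pos (- x))) meetDr.
by rewrite -{1}(opprK x) -{1}oppr0 meetN addNr.
Qed.

Lemma meet_subadd x y f : le 0 x -> le 0 y -> le 0 f ->
  le (meet (x + y) f) (meet x f + meet y f).
Proof.
move=> x0 y0 f0; rewrite [meet x f + _]addrC; apply: le_subl; apply: (bl_meet_greatest BL).
  apply: le_subr; rewrite [y + meet x f]addrC; apply: le_subl; apply: (bl_meet_greatest BL).
    by apply: le_subr; exact: le_meetl.
  apply: le_subr; apply: (le_tr (le_meetr _ _)).
  by rewrite -{1}(addr0 f); apply: leD.
apply: le_subr; apply: (le_tr (le_meetr _ _)).
by rewrite -{1}(addr0 f); apply: leD => //; exact: meet_ge0.
Qed.

Lemma disj_le x y f : le 0 x -> le 0 f -> le x y -> meet y f = 0 -> meet x f = 0.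
Proof.
move=> x0 f0 xy yf; apply: (bl_antisym BL); last exact: meet_ge0.
by rewrite -yf; exact: le_meet.
Qed.

Lemma disjD x y f : le 0 x -> le 0 y -> le 0 f ->
  meet x f = 0 -> meet y f = 0 -> meet (x + y) f = 0.
Proof.
move=> x0 y0 f0 xf yf; apply: (bl_antisym BL).
  by have := meet_subadd x0 y0 f0; rewrite xf yf addr0.
by apply: meet_ge0 => //; rewrite -(addr0 0); exact: leD.
Qed.

(** With [q = max(r, 1)], the element [q^-1 *: (r *: x /\ f)] lies below both [x] and [f]. *)
Lemma disjZ r x f : 0 <= r -> le 0 x -> le 0 f -> meet x f = 0 -> meet (r *: x) f = 0.
Proof.
move=> r0 x0 f0 xf; set m := meet _ f.
have m0 : le 0 m by apply: meet_ge0 => //; exact: scale_ge0.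
pose q := Num.max r 1.
have q1 : 1 <= q by rewrite /q le_max lexx orbT.
have qr : r <= q by rewrite /q le_max lexx.
have q0 : 0 < q by lra.
have qV : 0 <= q^-1 by rewrite invr_ge0 ltW.
apply: (bl_antisym BL) => //.
have : le (q^-1 *: m) 0.
  rewrite -xf; apply: (bl_meet_greatest BL).
    rewrite -[X in le _ X](scalerK (lt0r_neq0 q0)); apply: (bl_scale BL) => //.
    by apply: (le_tr (le_meetl _ _)); exact: le_scalel.
  apply: (le_tr _ (le_meetr (r *: x) f)); rewrite -[X in le _ X]scale1r.
  by apply: le_scalel => //; rewrite invf_le1.
by move/(bl_scale BL (ltW q0)); rewrite scaler0 scalerA divff ?scale1r ?lt0r_neq0.
Qed.

(** * Absolute value, norm and the Archimedean property *)

Lemma labs_ge x : le x (labs join x).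
Proof. exact: le_joinl. Qed.

Lemma labs_geN x : le (- x) (labs join x).
Proof. exact: le_joinr. Qed.

Lemma labs_ge0 x : le 0 (labs join x).
Proof.
have := bl_scale BL (_ : 0 <= 2^-1) (leD (labs_ge x) (labs_geN x)).
rewrite subrr scaler0 => /(_ (ltac:(by rewrite invr_ge0))).
by rewrite -[labs join x + _]mulr2n -(scaler_nat _ (labs join x)) scalerA mulVf ?scale1r ?pnatr_eq0.
Qed.

Lemma labs_id x : le 0 x -> labs join x = x.
Proof.
move=> x0; rewrite /labs joinC; apply: join_idr; apply: (le_tr _ x0).
by rewrite -[X in le _ X]oppr0; exact: leN.
Qed.

Lemma norm_pos_le x y : le x y -> `|pos x| <= `|y|.
Proof.
move=> xy; apply: (bl_norm BL); rewrite (labs_id (pos_ge0 _)).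
by apply: pos_le (labs_ge0 _); exact: (le_tr xy (labs_ge _)).
Qed.

Lemma norm_le x y : le 0 x -> le x y -> `|x| <= `|y|.
Proof.
move=> x0 xy; apply: (bl_norm BL); rewrite labs_id // labs_id //.
exact: le_tr x0 xy.
Qed.

(** The norm is monotone on positive elements, so [n * |x^+| <= |y^+|] for all [n], which forces
    [x^+ = 0]. *)
Lemma le_archimedean x y : (forall n : nat, le (n%:R *: x) y) -> le x 0.
Proof.
move=> h; apply: pos_eq0_le; apply/eqP; rewrite -normr_eq0; apply/eqP.
apply/eqP; rewrite eq_le normr_ge0 andbT leNgt; apply/negP => p0.
have H n : n%:R * `|pos x| <= `|pos y|.
  rewrite -(normr_nat R n) -normrZ; apply: norm_le.
    exact: scale_ge0 (pos_ge0 _).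
  case: n => [|n]; first by rewrite scale0r; exact: pos_ge0.
  have n0 : (0 : R) < n.+1%:R by rewrite ltr0n.
  have := bl_scale BL (_ : 0 <= n.+1%:R^-1 :> R) (le_pos2 (h n.+1)).
  move=> /(_ (ltac:(by rewrite invr_ge0 ltW))) H.
  have : le (pos x) (n.+1%:R^-1 *: pos y).
    apply: pos_le; last by apply: scale_ge0 (pos_ge0 _); rewrite invr_ge0 ltW.
    apply: le_tr H; rewrite -[X in le X _](scalerK (lt0r_neq0 n0)).
    by apply: (bl_scale BL); [rewrite invr_ge0 ltW|exact: le_pos].
  by move/(bl_scale BL (ltW n0)); rewrite scalerA divff ?lt0r_neq0 // scale1r.
have := archi_boundP (divr_ge0 (normr_ge0 (pos y)) (ltW p0)).
rewrite ltNge => /negP; apply.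
by rewrite ler_pdivlMr.
Qed.

Lemma le_archimedean_inv x y : (forall n : nat, le x (n.+1%:R^-1 *: y)) -> le x 0.
Proof.
move=> h; apply: (@le_archimedean x (pos y)) => -[|n].
  by rewrite scale0r; exact: pos_ge0.
have n0 : (0 : R) < n.+1%:R by rewrite ltr0n.
have := bl_scale BL (ltW n0) (h n).
by rewrite scalerA divff ?lt0r_neq0 // scale1r => /le_tr; apply; exact: le_pos.
Qed.

(** * Dedekind completeness from order continuity *)

Lemma le_subC x y z : le z (y - x) -> le x (y - z).
Proof. by move=> /sub_ge0 h; apply/sub_ge0; rewrite addrAC. Qed.

Lemma norm_lt_eq0 x : (forall r, 0 < r -> `|x| < r) -> x = 0.
Proof.
move=> h; apply/eqP; rewrite -normr_le0 leNgt; apply/negP => /h.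
by rewrite ltxx.
Qed.

(* The gaps y - x between the members x of A and its upper bounds y decrease to 0, so order
   continuity makes A a norm Cauchy net, whose limit is the supremum. *)
Lemma directed_sup (A : set E) : order_continuous le ->
  A !=set0 -> (forall x y, A x -> A y -> A (join x y)) ->
  (exists y, forall x, A x -> le x y) ->
  exists s : E, (forall x, A x -> le x s) /\
    forall y, (forall x, A x -> le x y) -> le s y.
Proof.
move=> OC [x0 Ax0] Aj [y0 Uy0].
pose U := [set y | forall x, A x -> le x y].
pose I := ({x | A x} * {y | U y})%type.
pose leI (i j : I) := le (sval i.1) (sval j.1) /\ le (sval j.2) (sval i.2).
have gap r : 0 < r -> exists x y, [/\ A x, U y & `|y - x| < r].
  move=> r0; have [||||i /(_ i)] := @OC I leI (fun i => sval i.2 - sval i.1) _ _ _ _ r r0.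
  - split=> [|i|i j k [ij1 ij2] [jk1 jk2]|i j].
    + by constructor; split; [exists x0|exists y0].
    + by split; exact: le_refl.
    + by split; [exact: le_tr jk1|exact: le_tr ij2].
    + have Ak := Aj _ _ (svalP i.1) (svalP j.1).
      have Uk : U (meet (sval i.2) (sval j.2)).
        move=> x Ax; apply: (bl_meet_greatest BL); first exact: (svalP i.2).
        exact: (svalP j.2).
      exists (exist _ _ Ak, exist _ _ Uk).
      by split; (split; [rewrite /=|rewrite /=]);
        by [exact: le_joinl|exact: le_joinr|exact: le_meetl|exact: le_meetr].
  - by move=> i j [ij1 ij2]; apply: leD => //; exact: leN.
  - by move=> i; apply/sub_ge0; exact: (svalP i.2 _ (svalP i.1)).
  (* If [z] lies below every gap, subtracting it from an upper bound leaves an upper bound. By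
     induction [y0 - n z] bounds [A] for all [n], so [z <= 0]. *)
  - move=> z zl; apply: (@le_archimedean z (y0 - x0)) => n; apply: le_subC.
    suff : U (y0 - n%:R *: z) by apply.
    elim: n => [|n IH] x Ax; first by rewrite scale0r subr0; exact: Uy0.
    rewrite -natr1 scalerDl scale1r opprD addrA; apply: le_subC.
    exact: (zl (exist _ x Ax, exist _ _ IH)).
  - move=> /(_ (conj (le_refl _) (le_refl _))) h.
    by exists (sval i.1), (sval i.2); split => //; [exact: svalP i.1|exact: svalP i.2].
(* [F] is generated by the tails of [A], directed upwards by [join]. *)
pose F : set_system E := [set S | exists x1, A x1 /\ forall x, A x -> le x1 x -> S x].
have FF : ProperFilter F.
  apply: Build_ProperFilter_ex.
    by move=> S [x [Ax h]]; exists x; exact: (h _ Ax (le_refl _)).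
  split; first by exists x0.
    move=> P Q [x [Ax hx]] [y [Ay hy]]; exists (join x y); split; first exact: Aj.
    move=> z Az h; split; first by apply: hx => //; apply: le_tr h; exact: le_joinl.
    by apply: hy => //; apply: le_tr h; exact: le_joinr.
  by move=> P Q PQ [x [Ax hx]]; exists x; split=> // z Az xz; apply: PQ; exact: hx.
have Fc : cauchy F.
  apply: cauchy_exP => r r0; have [x [y [Ax Uy xy]]] := gap r r0.
  exists x, x; split=> // z Az xz; rewrite -ball_normE /ball_ /=.
  rewrite distrC; apply: le_lt_trans xy; apply: norm_le.
    exact/sub_ge0.
  by apply: leD; [exact: Uy|exact: le_refl].
pose s := lim F.
have Fs r : 0 < r -> exists x1, A x1 /\ forall x, A x -> le x1 x -> `|s - x| < r.
  move=> r0; have Fcv : cvg F by exact: cauchy_cvg.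
  have /= := Fcv _ (nbhsx_ballx s r r0).
  by rewrite -ball_normE.
(* Each inequality says that a positive part vanishes; its norm is bounded by the distance from [s]
   to a late member of [A]. *)
exists s; split=> [x Ax|y Uy]; apply/sub_ge0; rewrite -[X in le X _]oppr0 -opprB; apply: leN;
  apply: pos_eq0_le; apply: norm_lt_eq0 => r /Fs [z [Az hz]].
  have h := hz (join x z) (Aj _ _ Ax Az) (le_joinr _ _).
  apply: le_lt_trans h; rewrite distrC; apply: norm_pos_le.
  by apply: leD (le_refl _); exact: le_joinl.
apply: le_lt_trans (hz z Az (le_refl _)); apply: norm_pos_le.
by apply: leD (le_refl _) _; apply: leN; exact: Uy.
Qed.

(** * Maximal filters of positive elements *)

(** Maximality is stated in the form in which it is used: a positive element outside [w] is disjoint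
    from a member. Upward closure is hidden in [ultra_meetP], because [a <= b] means
    [meet a b = a]. *)
Record ultra (w : set E) : Prop := {
  ultra_ne : exists e, w e;
  ultra_meetP : forall a b, w (meet a b) <-> w a /\ w b;
  ultra_ge0 : forall a, w a -> le 0 a;
  ultra_neq0 : forall a, w a -> a <> 0;
  ultra_dichotomy : forall a, le 0 a -> w a \/ exists2 f, w f & meet a f = 0
}.

Lemma ultra_meet w a b : ultra w -> w a -> w b -> w (meet a b).
Proof. by move=> Uw wa wb; apply/(ultra_meetP Uw). Qed.

Lemma meetxx x : meet x x = x.
Proof. exact: meet_idl (le_refl _). Qed.

Lemma meet0x x : le 0 x -> meet 0 x = 0.
Proof. exact: meet_idl. Qed.

(** Zorn's lemma is applied to filters all of whose members meet [e]; a maximal one contains [e] and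
    satisfies the dichotomy. *)
Lemma ultra_exists e : le 0 e -> e <> 0 -> exists2 w, ultra w & w e.
Proof.
move=> e0 en0.
pose P (A : set E) := [/\ forall a b, A a -> A b -> A (meet a b),
  forall a b, A a -> le a b -> A b, forall a, A a -> le 0 a
  & forall a, A a -> meet a e <> 0].
have [F FP Ftot|A [[Am Au A0 Ae] Amax]] := @Zorn_bigcup E P.
  split=> [a b [B FB Ba] [C FC Cb]|a b [B FB Ba] ab|a [B FB Ba]|a [B FB Ba]].
  - have [BC|CB] := Ftot _ _ FB FC.
      by exists C => //; have [Cm _ _ _] := FP _ FC; apply: Cm => //; exact: BC.
    by exists B => //; have [Bm _ _ _] := FP _ FB; apply: Bm => //; exact: CB.
  - by exists B => //; have [_ Bu _ _] := FP _ FB; exact: Bu ab.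
  - by have [_ _ B0 _] := FP _ FB; exact: B0.
  - by have [_ _ _ Be] := FP _ FB; exact: Be.
have ext c : le 0 c -> meet c e <> 0 -> (forall a, A a -> meet (meet a c) e <> 0) -> A c.
  move=> c0 ce ace; apply: contrapT => nAc.
  (* [B] is the filter generated by [A] and [c]. Allowing [a = c] puts [c] into [B] even if [A] is
     empty. *)
  pose B := [set b | exists2 a, A a \/ a = c & le (meet a c) b].
  apply: (Amax B).
    split; last by move/(_ c) => /(_ _) BA; apply/nAc/BA; exists c; [right|exact: le_meetl].
    by move=> a Aa; exists a; [left|exact: le_meetl].
  have A'0 a : A a \/ a = c -> le 0 a by move=> [/A0|->].
  split.
  - move=> b b' [a Aa ab] [a' Aa' ab'].
    have [a2 Aa2 [aa2 aa2']] : exists2 a2, A a2 \/ a2 = c &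
      le (meet a2 c) (meet a c) /\ le (meet a2 c) (meet a' c).
      case: Aa => [Aa|->]; last first.
        by exists a' => //; split; [rewrite meetxx; exact: le_meetr|exact: le_refl].
      case: Aa' => [Aa'|->]; last first.
        by exists a; [left|split; [exact: le_refl|rewrite meetxx; exact: le_meetr]].
      exists (meet a a'); first by left; exact: Am.
      split; apply: le_meet (le_refl _); [exact: le_meetl|exact: le_meetr].
    by exists a2 => //; apply: (bl_meet_greatest BL); [exact: le_tr ab|exact: le_tr ab'].
  - by move=> b b' [a Aa ab] bb'; exists a => //; exact: le_tr bb'.
  - by move=> b [a Aa ab]; apply: le_tr ab; apply: meet_ge0 => //; exact: A'0.
  - move=> b [a Aa ab] be.
    have : meet (meet a c) e = 0.
      by apply: disj_le ab be => //; apply: meet_ge0 => //; exact: A'0.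
    by case: Aa => [/ace|->] //; rewrite meetxx.
have AE : A e.
  apply: ext => //; first by rewrite meetxx.
  by move=> a /Ae; rewrite -meetA meetxx.
exists A => //; split=> //; first by exists e.
  split=> [Aab|[Aa Ab]]; last exact: Am.
  by split; apply: (Au _ _ Aab); [exact: le_meetl|exact: le_meetr].
  by move=> a Aa az; apply: (Ae _ Aa); rewrite az; exact: meet0x.
(* As [e] is now in [A], an element [c] disjoint from no member of [A] satisfies both conditions of
   [ext]. *)
move=> c c0; apply: contrapT => /not_orP[nAc h].
have h' f : A f -> meet c f <> 0 by move=> Af cf; apply: h; exists f.
apply/nAc/ext => //; first exact: h'.
by move=> a Aa; rewrite [meet a c]meetC -meetA; apply/h'/Am.
Qed.

Lemma maximal_disjoint_family : exists D : set E,
  [/\ forall u, D u -> le 0 u,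
   forall u v, D u -> D v -> u <> v -> meet u v = 0 &
   forall e, le 0 e -> e <> 0 -> exists2 u, D u & meet e u <> 0].
Proof.
pose P (D : set E) := (forall u, D u -> le 0 u) /\
   forall u v, D u -> D v -> u <> v -> meet u v = 0.
have [F FP Ftot|D [[D0 Dd] Dmax]] := @Zorn_bigcup E P.
  split=> [a [B FB Ba]|a b [B FB Ba] [C FC Cb]].
  - by have [B0 _] := FP _ FB; exact: B0.
  - have [BC|CB] := Ftot _ _ FB FC.
      by have [_ Cd] := FP _ FC; apply: Cd => //; exact: BC.
    by have [_ Bd] := FP _ FB; apply: Bd => //; exact: CB.
exists D; split=> // e e0 en0; apply: contrapT => h.
have h' u : D u -> meet e u = 0.
  by move=> Du; apply: contrapT => eu; apply: h; exists u.
apply: (Dmax (D `|` [set e])).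
  split; first by move=> u; left.
  by move=> /(_ e (or_intror erefl)) /h'; rewrite meetxx.
split=> [u [/D0|->]|u v] // [Du|->] [Dv|->] // uv.
- exact: Dd.
- by rewrite meetC; exact: h'.
- exact: h'.
Qed.

(** * The germ preorder at a maximal filter *)

Section Germs.
Variables (w : set E) (Uw : ultra w).

(** The elements whose absolute value is disjoint from some member of [w] form a prime ideal; this
    is the order of the quotient by it. *)
Definition gle a b := exists2 f, w f & meet (pos (a - b)) f = 0.

Let w0 f : w f -> le 0 f. Proof. exact: ultra_ge0. Qed.

Lemma gle_le a b : le a b -> gle a b.
Proof.
move=> ab; have [f wf] := ultra_ne Uw; exists f => //.
rewrite pos_eq0; first by apply: meet0x; exact: w0.
by apply: le_subr; rewrite add0r.
Qed.

(** Here [(x - y)^+ <= r (a - b)^+ + s (c - d)^+], and the right side is disjoint from [meet f g].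
    Transitivity, additivity and scaling are all instances. *)
Lemma gle_pos_bound r s a b c d x y : 0 <= r -> 0 <= s ->
  x - y = r *: (a - b) + s *: (c - d) -> gle a b -> gle c d -> gle x y.
Proof.
move=> r0 s0 xy [f wf af] [g wg bg]; exists (meet f g); first exact: ultra_meet.
have fg0 : le 0 (meet f g) by apply: meet_ge0; exact: w0.
apply: (@disj_le _ (r *: pos (a - b) + s *: pos (c - d))) => //.
- exact: pos_ge0.
- by rewrite xy; apply: (le_tr (posD _ _)); apply: leD; exact: posZ.
- have P0 z : le 0 (pos z) by exact: pos_ge0.
  apply: disjD => //; try by apply: scale_ge0.
    apply: disjZ => //; rewrite meetC; apply: disj_le (le_meetl f g) _ => //.
    by rewrite meetC.
  apply: disjZ => //; rewrite meetC; apply: disj_le (le_meetr f g) _ => //.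
  by rewrite meetC.
Qed.

Lemma gle_trans b a c : gle a b -> gle b c -> gle a c.
Proof.
by apply: (@gle_pos_bound 1 1) => //; rewrite !scale1r addrA subrK.
Qed.

Lemma gleD a b c d : gle a b -> gle c d -> gle (a + c) (b + d).
Proof.
by apply: (@gle_pos_bound 1 1) => //; rewrite !scale1r opprD addrACA.
Qed.

Lemma gleZ r a b : 0 <= r -> gle a b -> gle (r *: a) (r *: b).
Proof.
move=> r0 ab; apply: (gle_pos_bound r0 (lexx 0) _ ab ab).
by rewrite scale0r addr0 scalerBr.
Qed.

Lemma gleN a b : gle a b -> gle (- b) (- a).
Proof. by move=> [f wf h]; exists f => //; rewrite opprK addrC. Qed.

(** Either some member is disjoint from [(a - b)^+], or [(a - b)^+] is itself a member, and it is
    disjoint from [(b - a)^+]. *)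
Lemma gle_total a b : gle a b \/ gle b a.
Proof.
have [wab|[f wf h]] := ultra_dichotomy Uw (pos_ge0 (a - b)); last by left; exists f.
by right; exists (pos (a - b)) => //; rewrite meetC -(opprB a); exact: disj_pos.
Qed.

Lemma gle_join a b : gle a b -> gle (join a b) b.
Proof.
move=> [f wf h]; exists f => //.
suff -> : join a b - b = pos (a - b).
  by rewrite /pos joinC join_idr //; exact: pos_ge0.
by rewrite /pos -joinDr subrr.
Qed.

Variables (u : E) (wu : w u).

(** A failure would give [u <= 0] at [w], so [u] would be disjoint from a member of [w], although
    [u] itself is one. *)
Lemma gle_scale_unit r s : gle (r *: u) (s *: u) -> r <= s.
Proof.
move=> h; rewrite leNgt; apply/negP => sr.
have rs : 0 < r - s by lra.
have [f wf] : gle u 0.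
  have /gleZ : 0 <= (r - s)^-1 by rewrite invr_ge0 ltW.
  have : gle ((r - s) *: u) 0.
    rewrite scalerBl -(subrr (s *: u)); apply: gleD h _; exact: gle_le (le_refl _).
  by move=> h' /(_ _ _ h'); rewrite scaler0 scalerA mulVf ?scale1r ?lt0r_neq0.
rewrite subr0 /pos joinC join_idr; last exact: w0.
exact: ultra_neq0 Uw _ (ultra_meet Uw wu wf).
Qed.

(* [r] is the value of [e] relative to the unit [u], up to infinitesimals. *)
Definition gval e r := forall t, 0 < t -> gle ((r - t) *: u) e /\ gle e ((r + t) *: u).

Lemma gval_le a b r s : gval a r -> gval b s -> gle a b -> r <= s.
Proof.
move=> ar bs ab; rewrite leNgt; apply/negP => sr.
have t0 : 0 < (r - s) / 4 by lra.
have [h _] := ar _ t0; have [_ h'] := bs _ t0.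
have := gle_scale_unit (gle_trans (gle_trans h ab) h'); lra.
Qed.

Lemma gval_uniq e r s : gval e r -> gval e s -> r = s.
Proof.
by move=> er es; apply/eqP; rewrite eq_le; apply/andP; split; apply: gval_le (gle_le (le_refl e)).
Qed.

(** The value is the supremum of the [t] with [t u <= e] at [w]. Totality turns the failure of
    [t u <= e] above the supremum into the upper estimate. *)
Lemma gval_exists e r : gle (- (r *: u)) e -> gle e (r *: u) -> exists s, gval e s.
Proof.
move=> re er; pose A := [set t | gle (t *: u) e].
have An : A !=set0 by exists (- r); rewrite /A /= scaleNr.
have Ab : has_ubound A.
  by exists r => t At; apply: gle_scale_unit; apply: gle_trans er.
exists (sup A) => t t0; split.
  have [|x Ax xt] := @sup_adherent _ A t t0; first by split.
  by apply: (gle_trans (gle_le (le_scalel (ltW xt) (w0 wu)))).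
have [//|h] := gle_total e ((sup A + t) *: u).
have := ub_le_sup Ab h; lra.
Qed.

Lemma gvalD a b r s : gval a r -> gval b s -> gval (a + b) (r + s).
Proof.
move=> ar bs t t0; have t2 : 0 < t / 2 by lra.
have [h1 h2] := ar _ t2; have [h3 h4] := bs _ t2.
have -> : r + s - t = (r - t / 2) + (s - t / 2) by lra.
have -> : r + s + t = (r + t / 2) + (s + t / 2) by lra.
by split; rewrite scalerDl; exact: gleD.
Qed.

Lemma gvalN a r : gval a r -> gval (- a) (- r).
Proof.
move=> ar t t0; have [h1 h2] := ar _ t0.
split; rewrite -[_ *: u]opprK -scaleNr; apply: gleN; rewrite opprD opprK //.
by rewrite opprK.
Qed.

Lemma gval0 : gval 0 0.
Proof.
move=> t t0; rewrite sub0r add0r scaleNr; split; apply: gle_le.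
  by rewrite -oppr0; apply: leN; apply: scale_ge0 (w0 wu); exact: ltW.
by apply: scale_ge0 (w0 wu); exact: ltW.
Qed.

Lemma gvalZ (c : R) a r : gval a r -> gval (c *: a) (c * r).
Proof.
wlog c0 : c a r / 0 <= c.
  move=> H ar; have [c0|/ltW c0] := leP 0 c; first exact: H.
  rewrite -[c]opprK scaleNr mulNr; apply: gvalN; apply: H => //; lra.
move: c0; rewrite le_eqVlt => /predU1P[<- _|c0 ar t t0].
  by rewrite scale0r mul0r; exact: gval0.
have [h1 h2] := ar (c^-1 * t) ltac:(by rewrite mulr_gt0 ?invr_gt0).
have e1 : c * r - t = c * (r - c^-1 * t) by rewrite mulrBr mulrA divff ?lt0r_neq0 ?mul1r.
have e2 : c * r + t = c * (r + c^-1 * t) by rewrite mulrDr mulrA divff ?lt0r_neq0 ?mul1r.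
by rewrite e1 e2 -!scalerA; split; apply: gleZ => //; exact: ltW.
Qed.

Lemma gval_eq a b r : gle a b -> gle b a -> gval a r -> gval b r.
Proof.
move=> ab ba ar t t0; have [h1 h2] := ar t t0.
by split; [exact: gle_trans ab|exact: gle_trans ba h2].
Qed.

(** By totality one may assume [a <= b] at [w]; then the join and [b] have the same germ. *)
Lemma gvalJ a b r s : gval a r -> gval b s -> gval (join a b) (Num.max r s).
Proof.
wlog ab : a b r s / gle a b.
  by move=> H ar bs; have [/H|/H] := gle_total a b; [apply|rewrite joinC maxC; apply].
move=> ar bs; rewrite (max_idPr (gval_le ar bs ab)).
by apply: gval_eq bs; [exact: gle_le (le_joinr _ _)|exact: gle_join].
Qed.

End Germs.

(** If every [p n] were disjoint from [g], then [x /\ g <= y / (n + 1)] for all [n], whence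
    [x /\ g = 0]. *)
Lemma disj_archimedean x y g (p : nat -> E) : le 0 x -> le 0 y -> le 0 g ->
  (forall n, le 0 (p n)) -> (forall n, le x (p n + n.+1%:R^-1 *: y)) ->
  meet x g <> 0 -> exists n, meet (p n) g <> 0.
Proof.
move=> x0 y0 g0 p0 xp xg; apply: contrapT => h; apply: xg.
have {}h n : meet (p n) g = 0 by apply: contrapT => pg; apply: h; exists n.
apply: (bl_antisym BL); last exact: meet_ge0.
apply: (@le_archimedean_inv _ y) => n.
have Ny : le 0 (n.+1%:R^-1 *: y) by apply: scale_ge0; rewrite ?invr_ge0.
apply: (le_tr (le_meet (xp n) (le_refl g))); apply: (le_tr (meet_subadd _ _ _)) => //.
by rewrite h add0r; exact: le_meetl.
Qed.

(** * The representation space *)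

Definition ultra_space := {w : set E | ultra w}.

HB.instance Definition _ := gen_eqMixin ultra_space.
HB.instance Definition _ := gen_choiceMixin ultra_space.

(** The sets [{w | e \in w}] are closed under binary intersection, corresponding to [meet], so they
    form a base and openness can be tested with a single [e]. *)
Definition ultra_open : set_system ultra_space :=
  [set A | forall w, A w -> exists2 e, sval w e & forall w', sval w' e -> A w'].

Lemma ultra_openT : ultra_open setT.
Proof. by move=> w _; have [e we] := ultra_ne (svalP w); exists e. Qed.

Lemma ultra_openI : setI_closed ultra_open.
Proof.
move=> A B oA oB w [/oA [a wa hA] /oB [b wb hB]]; exists (meet a b).
  by apply/(ultra_meetP (svalP w)).
by move=> w' /(ultra_meetP (svalP w'))[/hA ? /hB].
Qed.

Lemma ultra_open_bigU (I : Type) (f : I -> set ultra_space) :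
  (forall i, ultra_open (f i)) -> ultra_open (\bigcup_i f i).
Proof.
move=> of_ w [i _ /of_ [e we h]]; exists e => // w' /h fw'.
by exists i.
Qed.

HB.instance Definition _ := isOpenTopological.Build ultra_space
  ultra_openT ultra_openI ultra_open_bigU.

Lemma ultra_openE (A : set ultra_space) : open A = ultra_open A.
Proof. by []. Qed.

Definition ultra_base e : set ultra_space := [set w | sval w e].

Lemma open_ultra_base e : open (ultra_base e).
Proof. by rewrite ultra_openE => w we; exists e. Qed.

Lemma nbhs_ultra_base e (w : ultra_space) : sval w e -> nbhs w (ultra_base e).
Proof. by move=> we; apply: open_nbhs_nbhs; split => //; exact: open_ultra_base. Qed.

Lemma ultra_disj (w : set E) a b : ultra w -> w a -> w b -> meet a b <> 0.
Proof. by move=> Uw wa wb; apply: (ultra_neq0 Uw); exact: ultra_meet. Qed.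

(** If [e] lies in one filter and not in the other, the other has a member [f] disjoint from [e],
    and no filter contains both. *)
Lemma ultra_space_hausdorff : hausdorff_space ultra_space.
Proof.
move=> w v wv; suff : sval w = sval v.
  by case: w v {wv} => [w Uw] [v Uv] /= wv; exact: eq_exist.
apply/seteqP; split=> e he.
  have [//|[f vf ef]] := ultra_dichotomy (svalP v) (ultra_ge0 (svalP w) he).
  have [z [ze zf]] := wv _ _ (nbhs_ultra_base he) (nbhs_ultra_base vf).
  by have := ultra_disj (svalP z) ze zf.
have [//|[f wf ef]] := ultra_dichotomy (svalP w) (ultra_ge0 (svalP v) he).
have [z [zf ze]] := wv _ _ (nbhs_ultra_base wf) (nbhs_ultra_base he).
by have := ultra_disj (svalP z) ze zf.
Qed.

(** * The representation *)

Section Representation.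
Variable D : set E.
Hypothesis D_ge0 : forall u, D u -> le 0 u.
Hypothesis D_disj : forall u v : E, D u -> D v -> u <> v -> meet u v = 0.
Hypothesis D_max : forall e, le 0 e -> e <> 0 -> exists2 u, D u & meet e u <> 0.
Implicit Types w : ultra_space.

(** These are the points where [e] has a finite value: a unit is available and [e] lies between two
    of its multiples. *)
Definition rdom e : set ultra_space :=
  [set w | exists u r, [/\ D u, sval w u, gle (sval w) (- (r *: u)) e
                         & gle (sval w) e (r *: u)]].

(* At most one member of [D] lies in [w]; the junk value outside [rdom e] is [0]. *)
Definition rval e w : R :=
  xget 0 [set r | exists2 u, D u /\ sval w u & gval (sval w) u e r].

Lemma unit_uniq w (u v : E) : D u -> D v -> sval w u -> sval w v -> u = v.
Proof.
move=> Du Dv wu wv; apply: contrapT => uv.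
exact: ultra_disj (svalP w) wu wv (D_disj Du Dv uv).
Qed.

Lemma rvalP e w u : rdom e w -> D u -> sval w u -> gval (sval w) u e (rval e w).
Proof.
move=> [v [r [Dv wv h1 h2]]] Du wu; rewrite (unit_uniq Dv Du wv wu) in h1 h2.
have [s es] := gval_exists (svalP w) wu h1 h2.
rewrite /rval; case: xgetP => [r' _ [u' [Du' wu']]|/(_ s)].
  by rewrite (unit_uniq Du' Du wu' wu).
by case; exists u.
Qed.

Lemma rval_eq e w u r : rdom e w -> D u -> sval w u -> gval (sval w) u e r ->
  rval e w = r.
Proof. by move=> ew Du wu; apply: (gval_uniq (svalP w) wu); exact: rvalP. Qed.

Lemma rdom_unit e w : rdom e w -> exists2 u, D u & sval w u.
Proof. by move=> [u [r [Du wu _ _]]]; exists u. Qed.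

Lemma rvalD a b w : rdom a w -> rdom b w -> rdom (a + b) w ->
  rval (a + b) w = rval a w + rval b w.
Proof.
move=> wa wb wab; have [u Du wu] := rdom_unit wa.
by apply: (rval_eq wab Du wu); apply: (gvalD (svalP w)); exact: rvalP.
Qed.

Lemma rvalZ r a w : rdom a w -> rdom (r *: a) w -> rval (r *: a) w = r * rval a w.
Proof.
move=> wa wra; have [u Du wu] := rdom_unit wa.
by apply: (rval_eq wra Du wu); apply: (gvalZ (svalP w)) => //; exact: rvalP.
Qed.

Lemma rvalN a w : rdom a w -> rdom (- a) w -> rval (- a) w = - rval a w.
Proof. by rewrite -scaleN1r => wa wna; rewrite rvalZ // mulN1r. Qed.

Lemma rvalJ a b w : rdom a w -> rdom b w -> rdom (join a b) w ->
  rval (join a b) w = Num.max (rval a w) (rval b w).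
Proof.
move=> wa wb wab; have [u Du wu] := rdom_unit wa.
by apply: (rval_eq wab Du wu); apply: (gvalJ (svalP w)) => //; exact: rvalP.
Qed.

Lemma rval_gle a b w : gle (sval w) a b -> rdom a w -> rdom b w ->
  rval a w <= rval b w.
Proof.
move=> ab wa wb; have [u Du wu] := rdom_unit wa.
by apply: (gval_le (svalP w) wu _ _ ab); exact: rvalP.
Qed.

Lemma rval_le a b w : le a b -> rdom a w -> rdom b w -> rval a w <= rval b w.
Proof. by move=> /(gle_le (svalP w)); exact: rval_gle. Qed.

Lemma rdom0 w u : D u -> sval w u -> rdom 0 w.
Proof.
move=> Du wu; exists u, 0; split=> //; rewrite scale0r ?oppr0;
  exact: (gle_le (svalP w) (le_refl _)).
Qed.

Lemma rval0 w : rdom 0 w -> rval 0 w = 0.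
Proof.
move=> w0; have [u Du wu] := rdom_unit w0.
by apply: (rval_eq w0 Du wu); exact: (gval0 (svalP w)).
Qed.

Lemma rval_ge0 a w : le 0 a -> rdom a w -> 0 <= rval a w.
Proof.
move=> a0 wa; have [u Du wu] := rdom_unit wa; have w0 := rdom0 Du wu.
by rewrite -(rval0 w0); exact: rval_le.
Qed.

Lemma rval_gle0 a w : gle (sval w) a 0 -> rdom a w -> rval a w <= 0.
Proof.
move=> a0 wa; have [u Du wu] := rdom_unit wa; have w0 := rdom0 Du wu.
by rewrite -(rval0 w0); exact: rval_gle.
Qed.

(** A germ inequality has a single witness [f], so it persists at every filter containing [f].
    Openness of domains and continuity of values both rest on this. *)
Lemma gle_open (w : ultra_space) a b : gle (sval w) a b ->
  exists2 f, sval w f & forall w', sval w' f -> gle (sval w') a b.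
Proof. by move=> [f wf h]; exists f => // w' w'f; exists f. Qed.

Lemma open_rdom e : open (rdom e).
Proof.
rewrite ultra_openE => w [u [r [Du wu /gle_open[f wf hf] /gle_open[g wg hg]]]].
exists (meet u (meet f g)); first by do 2?apply: (ultra_meet (svalP w)).
move=> w' /(ultra_meetP (svalP w'))[w'u /(ultra_meetP (svalP w'))[/hf ? /hg ?]].
by exists u, r.
Qed.

Lemma dense_rdom e : dense (rdom e).
Proof.
move=> O [w Ow] /(_ w Ow)[a wa aO].
have a0 := ultra_ge0 (svalP w) wa; have an0 := ultra_neq0 (svalP w) wa.
have [u Du au] := D_max a0 an0.
set g := meet a u in au; have u0 := D_ge0 Du.
have g0 : le 0 g by exact: meet_ge0.
pose x := labs join e; have x0 : le 0 x by exact: labs_ge0.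
have N0 n : 0 <= n.+1%:R^-1 :> R by rewrite invr_ge0.
(* The choice gives [u <= p n + |e| / (n + 1)], so some [p n] must meet [g]. *)
pose p n := n.+1%:R^-1 *: pos (n.+1%:R *: u - x).
have p0 n : le 0 (p n) by apply: scale_ge0 (pos_ge0 _).
have [n fn0] : exists n, meet (p n) g <> 0.
  apply: (@disj_archimedean u x) => //.
    move=> n; have Nn0 : n.+1%:R != 0 :> R by rewrite pnatr_eq0.
    rewrite /p -scalerDr -[X in le X _](scalerK Nn0); apply: (bl_scale BL) => //.
    by apply: le_subl; exact: le_pos.
  by rewrite meetC meet_idl //; exact: le_meetr.
set f := meet (p n) g in fn0; have f0 : le 0 f by exact: meet_ge0.
have [v Uv vf] := ultra_exists f0 fn0.
have [vp vg] := (ultra_meetP Uv _ _).1 vf; have [va vu] := (ultra_meetP Uv _ _).1 vg.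
exists (exist _ v Uv); split; first exact: aO.
(* The positive part of [|e| - (n + 1) u] is disjoint from [p n], which belongs to [v]; hence [e] is
   finite at [v]. *)
have key y : le y x -> gle v y (n.+1%:R *: u).
  move=> yx; exists (p n) => //.
  apply: (@disj_le _ (pos (x - n.+1%:R *: u))) => //; first exact: pos_ge0.
    by apply: le_pos2; apply: leD (le_refl _).
  rewrite meetC; apply: disjZ => //; try exact: pos_ge0.
  by rewrite -(opprB (n.+1%:R *: u) x); exact: disj_pos.
exists u, n.+1%:R; split=> //=; last by apply: key; exact: labs_ge.
by rewrite -[X in gle _ _ X]opprK; apply: gleN; apply: key; exact: labs_geN.
Qed.

Lemma rval_cont e : {within rdom e, continuous (rval e)}.
Proof.
rewrite (continuous_open_subspace _ (@open_rdom e)) => w /set_mem we.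
have [u Du wu] := rdom_unit we.
apply/(cvgrPdist_lt (FF := nbhs_filter w)) => r r0.
have r2 : 0 < r / 2 by lra.
have [/gle_open[f wf hf] /gle_open[g wg hg]] := rvalP we Du wu r2.
have : nbhs w (rdom e `&` ultra_base (meet u (meet f g))).
  apply: open_nbhs_nbhs; split.
    by apply: openI; [exact: open_rdom|exact: open_ultra_base].
  by split => //; do 2?apply: (ultra_meet (svalP w)).
apply: filterS => v [ve /(ultra_meetP (svalP v))[vu /(ultra_meetP (svalP v))[/hf h1 /hg h2]]].
(* Tolerance [r / 2] at [w] and [r / 4] at [v] bound the difference of the values by
   [3 r / 4 < r]. *)
have r4 : 0 < r / 4 by lra.
have [h3 h4] := rvalP ve Du vu r4.
have := gle_scale_unit (svalP v) vu (gle_trans (svalP v) h1 h4).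
have := gle_scale_unit (svalP v) vu (gle_trans (svalP v) h3 h2).
rewrite ltr_distlC; lra.
Qed.

Definition rep e : SRep R ultra_space :=
  Build_SRep (@open_rdom e) (@dense_rdom e) (@rval_cont e).

(** * Reflection of the order and injectivity *)

(** If [e^+] is nonzero, it meets some unit [u], and then so does some [(e - u / (n + 1))^+]. On the
    nonempty basic open set so obtained, [e] has value at least [1 / (n + 1)] wherever it is finite,
    and [W] meets that set. *)
Lemma rval_le0_reflect (W : set ultra_space) e : dense W ->
  (forall w, W w -> rdom e w -> rval e w <= 0) -> le e 0.
Proof.
move=> dW eW; apply: pos_eq0_le; apply: contrapT => en0.
have [u Du eu] := D_max (pos_ge0 e) en0; have u0 := D_ge0 Du.
have N0 n : 0 <= n.+1%:R^-1 :> R by rewrite invr_ge0.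
pose p n := pos (e - n.+1%:R^-1 *: u).
have [n fn0] : exists n, meet (p n) u <> 0.
  apply: (disj_archimedean (pos_ge0 e) u0 u0 _ _ eu) => n; first exact: pos_ge0.
  have Nu : le 0 (n.+1%:R^-1 *: u) by exact: scale_ge0.
  apply: pos_le; first by apply: le_subl; exact: le_pos.
  by rewrite -(addr0 0); apply: leD => //; exact: pos_ge0.
have f0 : le 0 (meet (p n) u) by apply: meet_ge0 => //; exact: pos_ge0.
have [v Uv vf] := ultra_exists f0 fn0.
have ob := @open_ultra_base (meet (p n) u).
have [w [wb we]] : ultra_base (meet (p n) u) `&` rdom e !=set0.
  by apply: dense_rdom ob; exists (exist _ v Uv).
have [w' [[w'b w'e] Ww']] : (ultra_base (meet (p n) u) `&` rdom e) `&` W !=set0.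
  by apply: dW; [exists w|apply: openI => //; exact: open_rdom].
have [w'p w'u] := (ultra_meetP (svalP w') _ _).1 w'b.
have h : gle (sval w') (n.+1%:R^-1 *: u) e.
  by exists (p n) => //; rewrite meetC -(opprB e); exact: disj_pos.
have N1 : 0 < n.+1%:R^-1 :> R by rewrite invr_gt0 ltr0n.
move: (n.+1%:R^-1) N1 h => r r0 h.
have N2 : 0 < r / 2 by lra.
have [_ h'] := rvalP w'e Du w'u N2.
have := gle_scale_unit (svalP w') w'u (gle_trans (svalP w') h h').
have := eW _ Ww' w'e; lra.
Qed.

Lemma rval_le_reflect (W : set ultra_space) a b : dense W ->
  (forall w, W w -> rdom a w -> rdom b w -> rval a w <= rval b w) -> le a b.
Proof.
move=> dW abW; rewrite -[b]add0r; apply: le_subl.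
(* The dense set is shrunk so that the value of [a - b] can be computed term by term. *)
apply: (@rval_le0_reflect (rdom a `&` (rdom b `&` (rdom (- b) `&` W)))).
  by do 3?apply: (denseI (@open_rdom _) (@dense_rdom _)).
move=> w [wa [wb [wnb Ww]]] wab; rewrite rvalD // rvalN // subr_le0.
exact: abW.
Qed.

Lemma rval_inj_dense (W : set ultra_space) a b : dense W ->
  (forall w, W w -> rdom a w -> rdom b w -> rval a w = rval b w) -> a = b.
Proof.
move=> dW ab; apply: (bl_antisym BL); apply: (rval_le_reflect dW) => w Ww wa wb;
  by rewrite ab.
Qed.

(** * Bumps and the order dense ideal *)

(** For [g] with basic set inside [O] and a unit [u] meeting [g], take [d = g /\ u]: the bound
    [d <= u] gives values at most 1, and [d <= g] kills them off [O]. *)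
Lemma bump (O : set ultra_space) : open O -> O !=set0 ->
  exists d, [/\ le 0 d, d <> 0,
    (forall w, rdom d w -> rval d w <= 1) &
    forall w, rdom d w -> ~ O w -> rval d w = 0].
Proof.
move=> oO [w Ow]; have [g wg gO] := oO w Ow.
have g0 := ultra_ge0 (svalP w) wg.
have [u Du gu] := D_max g0 (ultra_neq0 (svalP w) wg); have u0 := D_ge0 Du.
have d0 : le 0 (meet g u) by exact: meet_ge0.
have key (v : ultra_space) f : sval v f -> meet (meet g u) f = 0 ->
    rdom (meet g u) v -> rval (meet g u) v = 0.
  move=> vf df vd; apply/eqP; rewrite eq_le rval_ge0 // andbT rval_gle0 //.
  by exists f => //; rewrite subr0 /pos joinC join_idr.
exists (meet g u); split=> // v vd; last first.
  move=> nO; have [vg|[f vf gf]] := ultra_dichotomy (svalP v) g0.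
    by exfalso; apply/nO/gO.
  apply: (key _ f vf) => //; apply: disj_le gf => //; last exact: le_meetl.
  exact: (ultra_ge0 (svalP v)).
have [u' Du' vu'] := rdom_unit vd.
(* Where the unit in [v] is not [u], it is disjoint from [u], hence from [d], and the value is 0. *)
have [uu'|uu'] := pselect (u = u'); last first.
  rewrite (key _ u' vu') //; apply: disj_le (D_disj Du Du' uu') => //.
    exact: D_ge0.
  exact: le_meetr.
subst u'; have v1 : gval (sval v) u u 1.
  move=> t t0; split; apply: (gle_le (svalP v)); rewrite -[X in le _ X]scale1r.
    by apply: le_scalel => //; lra.
  by rewrite scale1r -[X in le X _]scale1r; apply: le_scalel => //; lra.
apply: (gval_le (svalP v) vu' (rvalP vd Du vu') v1).
exact: (gle_le (svalP v) (le_meetr _ _)).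
Qed.

Local Notation sfun := Defs.sfun.

Lemma rvalDZ a b r w : rdom a w -> rdom b w -> rdom (r *: b) w ->
  rdom (a + r *: b) w -> rval (a + r *: b) w = rval a w + r * rval b w.
Proof. by move=> wa wb wrb wab; rewrite rvalD // rvalZ. Qed.

Lemma rval_abs e w : rdom e w -> rdom (- e) w -> rdom (labs join e) w ->
  rval (labs join e) w = `|rval e w|.
Proof. by move=> we wne wae; rewrite rvalJ // rvalN // maxrN. Qed.

Lemma meet_join a b : meet a b = - join (- a) (- b).
Proof. by rewrite -meetN !opprK. Qed.

(* The common domain on which [rval_un] can be computed term by term. *)
Definition rdom_un x y z : set ultra_space :=
  rdom x `&` (rdom y `&` (rdom z `&` (rdom (- y) `&` (rdom (x - y) `&`
  (rdom (- (x - y)) `&` (rdom (labs join (x - y)) `&`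
  (rdom (- labs join (x - y)) `&` (rdom (- z) `&`
  (rdom (join (- labs join (x - y)) (- z)) `&`
   rdom (meet (labs join (x - y)) z)))))))))).

Lemma dense_rdom_un x y z : dense (rdom_un x y z).
Proof. by do 10?apply: (denseI (@open_rdom _) (@dense_rdom _)); exact: dense_rdom. Qed.

Lemma rval_un x y z w : rdom_un x y z w ->
  rval (meet (labs join (x - y)) z) w = Num.min `|rval x w - rval y w| (rval z w).
Proof.
move=> [h1 [h2 [h3 [h4 [h5 [h6 [h7 [h8 [h9 [h10 h11]]]]]]]]]].
rewrite meet_join in h11 *.
rewrite rvalN // rvalJ // rvalN // rvalN // rval_abs // rvalD // rvalN //.
by rewrite -oppr_min opprK.
Qed.

(** The preimage is the supremum [m] of [{x | T x <= b}], a set containing [- |e|] and bounded by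
    [|e|]. A gap of either sign between [T m] and [b] would fit a multiple of a bump and contradict
    the choice of [m]. *)
Lemma rep_ideal_sup (b : SRep R ultra_space) e : order_continuous le ->
  (forall w, rdom e w -> sdom b w -> `|sfun b w| <= `|rval e w|) ->
  exists x, sequiv (rep x) b.
Proof.
move=> OC be; pose x0 := labs join e.
pose A := [set x | sle (rep x) b].
have dW1 : dense (rdom e `&` (rdom (- e) `&` (rdom x0 `&` rdom (- x0)))).
  by do 3?apply: (denseI (@open_rdom _) (@dense_rdom _)); exact: dense_rdom.
have An : A !=set0.
  exists (- x0); apply: (sle_of_dense dW1) => w [we [wne [wx wnx]]] _ wb /=.
  rewrite rvalN // rval_abs //; have := be w we wb.
  by move/(le_trans _); rewrite lerNl; apply; rewrite ler_normr lexx orbT.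
have Aj x y : A x -> A y -> A (join x y).
  move=> Ax Ay; apply: (@sle_of_dense _ _ (rdom x `&` rdom y)).
    by apply: (denseI (@open_rdom _) (@dense_rdom _)); exact: dense_rdom.
  move=> w [wx wy] wj wb /=; rewrite rvalJ // ge_max.
  by apply/andP; split; [exact: Ax|exact: Ay].
have Ab : exists y, forall x, A x -> le x y.
  exists x0 => x Ax; apply: (rval_le_reflect (@dense_sdomI _ _ b _ dW1)).
  move=> w [wb [we [wne [wx0 wnx]]]] wx _; apply: (le_trans (Ax w wx wb)).
  by rewrite rval_abs //; apply: le_trans (be w we wb); exact: ler_norm.
have [m [mub mlub]] := directed_sup OC An Aj Ab.
exists m.
have mb : sle (rep m) b.
  move=> w wm wb; rewrite leNgt; apply/negP.
  move=> /(near_lt_gap (sfun_continuous wb) (sfun_continuous wm))[r r0].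
  move/(nbhs_openI (nbhs_sdom wb)) => [G [oG Gw hG]].
  have [d [d0 dn0 d1 dG]] := bump oG (ex_intro _ w Gw).
  apply: dn0; apply: (bl_antisym BL) => //.
  (* Where [b + r <= T m] on [G], the element [m - r d] still bounds [A]: on [G] because [d] has
     values at most 1, off [G] because they are 0. *)
  have : le m (m + (- r) *: d).
    apply: mlub => x Ax.
    apply: (@rval_le_reflect (sdom b `&` (rdom m `&` (rdom d `&` rdom ((- r) *: d))))).
      by apply: dense_sdomI; do 2?apply: (denseI (@open_rdom _) (@dense_rdom _)); exact: dense_rdom.
    move=> v [vb [vm [vd vrd]]] vx vmd; rewrite rvalDZ //.
    have [Gv|nGv] := pselect (G v).
      have [_ h] := hG _ Gv; apply: (le_trans (Ax v vx vb)).
      rewrite mulNr lerBrDr; apply: le_trans h; rewrite lerD2l.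
      by rewrite ler_piMr ?d1 // ltW.
    by rewrite dG // mulr0 addr0; apply: rval_le => //; exact: mub.
  rewrite scaleNr => /(bl_add BL (- m)); rewrite subrr addrAC subrr add0r.
  move=> /leN; rewrite opprK oppr0 => /(bl_scale BL (_ : 0 <= r^-1)).
  by rewrite scalerA mulVf ?lt0r_neq0 // scale1r scaler0 invr_ge0 ltW //; apply.
move=> w wm wb; apply/eqP; rewrite eq_le mb //= leNgt; apply/negP.
move=> /(near_lt_gap (sfun_continuous wm) (sfun_continuous wb))[r r0].
move/(nbhs_openI (nbhs_sdom wb)) => [G [oG Gw hG]].
have [d [d0 dn0 d1 dG]] := bump oG (ex_intro _ w Gw).
apply: dn0; apply: (bl_antisym BL) => //.
(* In the opposite case [T m + r <= b] on [G], so [m + r d] still belongs to [A] and cannot exceed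
   [m]. *)
have : A (m + r *: d).
  apply: (@sle_of_dense _ _ (rdom m `&` (rdom d `&` rdom (r *: d)))).
    by do 2?apply: (denseI (@open_rdom _) (@dense_rdom _)); exact: dense_rdom.
  move=> v [vm [vd vrd]] vmd vb /=; rewrite rvalDZ //.
  have [Gv|nGv] := pselect (G v).
    have [_ h] := hG _ Gv; apply: le_trans h; rewrite lerD2l.
    by rewrite ler_piMr ?d1 // ltW.
  by rewrite dG // mulr0 addr0; exact: mb.
move=> /mub /(bl_add BL (- m)); rewrite subrr addrAC subrr add0r.
move=> /(bl_scale BL (_ : 0 <= r^-1)).
by rewrite scalerA mulVf ?lt0r_neq0 // scale1r scaler0 invr_ge0 ltW //; apply.
Qed.

Lemma rep_ideal : order_continuous le -> sideal (simage rep).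
Proof.
move=> OC; split.
- move=> a a0; exists 0 => w w0 wa /=; rewrite a0 //; exact: rval0.
- move=> a b c [x xa] [y yb] abc; exists (x + y).
  apply: (@sequiv_of_dense _ _ (sdom a `&` (sdom b `&` (rdom x `&` rdom y)))).
    by do 2?apply: dense_sdomI; apply: (denseI (@open_rdom _) (@dense_rdom _)); exact: dense_rdom.
  move=> w [wa [wb [wx wy]]] wxy wc /=.
  by rewrite rvalD // abc // -xa // -yb.
- move=> r a c [x xa] ac; exists (r *: x).
  apply: (@sequiv_of_dense _ _ (sdom a `&` rdom x)).
    by apply: dense_sdomI; exact: dense_rdom.
  by move=> w [wa wx] wrx wc /=; rewrite rvalZ // ac // -xa.
- move=> a b [e ea] ab; apply: (rep_ideal_sup OC (e := e)).
  move=> w we wb.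
  (* The bound is known only on [sdom a]; continuity carries it to the other points. *)
  refine (@le_of_dense _ _ (sdom a) (fun v => `|sfun b v|) (fun v => `|rval e v|) w _ _ _ _).
  + exact: sdom_dense.
  + by apply: continuous_norm_at; exact: sfun_continuous.
  + by apply: continuous_norm_at; exact: (sfun_continuous (a := rep e)).
  + apply: filterS2 (nbhs_sdom (a := rep e) we) (nbhs_sdom wb).
    by move=> v ve vb va; rewrite [rval e v](ea v) //; exact: ab.
Qed.

(** A nonzero positive [a] exceeds some constant [r > 0] on an open set, hence dominates [r] times a
    bump supported there. *)
Lemma rep_order_dense : sorder_dense (simage rep).
Proof.
move=> a a0 [w [wa aw]].
have aw0 : 0 < sfun a w by rewrite lt0r aw a0.
have c0 : {for w, continuous (fun _ : ultra_space => 0 : R)} by exact: cst_continuous.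
have [r r0] := near_lt_gap c0 (sfun_continuous wa) aw0.
move/(nbhs_openI (nbhs_sdom wa)) => [G [oG Gw hG]].
have [d [d0 dn0 d1 dG]] := bump oG (ex_intro _ w Gw).
have rd0 : le 0 (r *: d) by apply: scale_ge0 => //; exact: ltW.
exists (rep (r *: d)); split.
- by exists (r *: d).
- by move=> v vrd; exact: rval_ge0.
- apply: contrapT => h; apply: dn0; apply: (bl_antisym BL) => //.
  apply: (rval_le0_reflect (@dense_rdom (r *: d))) => v vrd vd.
  suff : rval (r *: d) v = 0.
    rewrite rvalZ // => /eqP; rewrite mulf_eq0 gt_eqF //= => /eqP->.
    exact: lexx.
  by apply: contrapT => /eqP rn0; apply: h; exists v.
- apply: (sle_of_dense (@dense_rdom d)) => v vd vrd va /=.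
  rewrite rvalZ //; have [Gv|nGv] := pselect (G v).
    have [_] := hG _ Gv; rewrite add0r; apply: le_trans.
    by rewrite ler_piMr ?d1 // ltW.
  by rewrite dG // mulr0; exact: a0.
Qed.

(** * Comparison of the two convergences *)

(** Both sides measure the same vector [|x i - x0| /\ w]: positive elements of the image come from
    positive [w], and the vector is determined by its values on a dense set. *)
Lemma rep_un (I : Type) (leI : I -> I -> Prop) (x : I -> E) (x0 : E) :
  un_conv le join meet leI x x0 <-> ext_un_conv rep leI (fun i => rep (x i)) (rep x0).
Proof.
split=> [h w' [w ww'] w'0 r r0|h w w0 r r0].
  have w0 : le 0 w.
    apply: (rval_le_reflect (@sdom_dense _ _ w')) => v vw' v0 vw.
    by rewrite rval0 // [rval w v](ww' v) //; exact: w'0.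
  have [i0 hi0] := h w w0 r r0; exists i0 => i /hi0 hi.
  exists (meet (labs join (x i - x0)) w); split=> // v ve vx vx0 vw'.
  (* The formula for the values is available on [rdom_un] only; continuity of [F] extends it to the
     whole common domain. *)
  pose F := (fun v => `|sfun (rep (x i)) v - sfun (rep x0) v|) \min sfun w'.
  refine (@eq_of_dense _ _ (rdom_un (x i) x0 w) (rval (meet (labs join (x i - x0)) w)) F v _ _ _ _).
  - exact: dense_rdom_un.
  - exact: (sfun_continuous ve).
  - apply: continuous_min; last exact: (sfun_continuous vw').
    exact: (continuous_dist_at (sfun_continuous vx) (sfun_continuous vx0)).
  - have := nbhs_sdom vw'; apply: filterS => y yw' yW.
    rewrite /F /= rval_un // [rval w y](ww' y) //.
    by case: yW => _ [_ []].
have [|v vw|i0 hi0] := h (rep w) _ _ r r0.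
- by exists w.
- exact: rval_ge0.
exists i0 => i /hi0 [e [he er]].
(* The witness [e] has the same values as this meet on a dense set, so its norm bound transfers. *)
suff -> : meet (labs join (x i - x0)) w = e by [].
apply: (rval_inj_dense (@dense_rdom_un (x i) x0 w)) => v vW _ ve.
by rewrite rval_un // -he //; case: vW => ? [? []].
Qed.

End Representation.

End VectorLattice.

Theorem theorem3p8 (R : realType) (E : completeNormedModType R)
  (le : E -> E -> Prop) (join meet : E -> E -> E) :
  banach_lattice le join meet ->
  order_continuous le ->
  exists (X : topologicalType) (T : E -> SRep R X),
    [/\ hausdorff_space X,
        (* T is injective (as a map into S(X)) *)
        (forall a b, sequiv (T a) (T b) -> a = b),
        (* T is a lattice homomorphism *)
        [/\ (forall a b, sbin_rel +%R (T a) (T b) (T (a + b))),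
            (forall (c : R) a, sscale_rel c (T a) (T (c *: a))) &
            (forall a b, sbin_rel Num.max (T a) (T b) (T (join a b)))],
        (* T(E) is an order dense ideal of S(X) *)
        sideal (simage T) /\ sorder_dense (simage T) &
        (* T : (E, un) -> (T(E), tau_E) is a homeomorphism *)
        forall (I : Type) (leI : I -> I -> Prop) (x : I -> E) (x0 : E),
          directed leI ->
          (un_conv le join meet leI x x0 <-> ext_un_conv T leI (fun i => T (x i)) (T x0))].
Proof.
move=> BL OC; have [D [D_ge0 D_disj D_max]] := maximal_disjoint_family BL.
exists (ultra_space le meet), (rep BL D_ge0 D_disj D_max); split.
- exact: ultra_space_hausdorff.
- move=> a b ab.
  apply: (rval_inj_dense BL D_ge0 D_disj D_max (dense_rdom BL D_ge0 D_max a)) => w _.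
  exact: ab.
- split.
  + by move=> a b w; exact: (rvalD BL D_disj).
  + by move=> c a w; exact: (rvalZ BL D_disj).
  + by move=> a b w; exact: (rvalJ BL D_disj).
- by split; [exact: rep_ideal|exact: rep_order_dense].
- by move=> I leI x x0 _; exact: rep_un.
Qed.
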